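(* Let $t\in[0,1)$ and $x^{[0]}:=\alpha_0(t^n)_{n\in\mathbb{N}_0}$ with $\alpha_0\in\mathbb{C}\setminus\{0\}$. (i) The generalized Cesàro operator $C_t\in\mathcal{L}(\omega)$ is power bounded and uniformly mean ergodic. (ii) $\mathrm{Ker}(I-C_t)=\mathrm{span}\{x^{[0]}\}$ and the range $$(I-C_t)(\omega)=\{x\in\omega: x_0=0\}=\overline{\mathrm{span}\{e_r: r\in\mathbb{N}\}}$$ of $I-C_t$ is closed in $\omega$. (iii) The operator $C_t$ is not supercyclic in $\omega$.
   Context: $\mathbb{N}_0=\{0,1,2,\dots\}$, $\mathbb{N}=\{1,2,\dots\}$, and $\omega:=\mathbb{C}^{\mathbb{N}_0}$ is the Fréchet space of all complex sequences with the topology of coordinatewise convergence; $e_r:=(\delta_{rj})_{j\in\mathbb{N}_0}$. For $t\in[0,1]$, $C_tx:=\left(\frac{t^nx_0+t^{n-1}x_1+\dots+x_n}{n+1}\right)_{n\in\mathbb{N}_0}$ for $x\in\omega$ (with $0^0:=1$). For a locally convex Hausdorff space $X$, $\mathcal{L}(X)$ is the space of continuous linear operators on $X$ and $\mathcal{L}_b(X)$ is $\mathcal{L}(X)$ with the topology of uniform convergence on bounded subsets of $X$. $T\in\mathcal{L}(X)$ is power bounded if $\{T^n:n\in\mathbb{N}\}$ is equicontinuous. $T$ is uniformly mean ergodic if the sequence of Cesàro means $T_{[n]}:=\frac1n\sum_{m=1}^nT^m$, $n\in\mathbb{N}$, converges in $\mathcal{L}_b(X)$. $T$ is supercyclic if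 there is $x\in X$ such that $\{\lambda T^nx:\lambda\in\mathbb{C},\ n\in\mathbb{N}_0\}$ is dense in $X$. *)

(* Defs.v *)
From HB Require Import structures.
From mathcomp Require Import all_boot all_order all_algebra.
From mathcomp Require Import all_classical all_reals all_analysis.
From mathcomp Require Import complex.

Set Implicit Arguments.
Unset Strict Implicit.
Unset Printing Implicit Defensive.

Import Order.TTheory GRing.Theory Num.Theory.
Import numFieldNormedType.Exports.

Local Open Scope classical_set_scope.
Local Open Scope ring_scope.
Local Open Scope complex_scope.

Section TopologicalVectorSpaces.
Context {K : numFieldType} {E : tvsType K}.
Implicit Types (T : E -> E) (A B U : set E).

(* [continuous_linear] is L(E), as a set of functions. *)
Definition continuous_linear : set (E -> E) :=
  [set T | linear T /\ continuous T].

(* Bounded in the sense of von Neumann; the library's [bounded_set] is about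
   norm-bounded subsets of a normed module. *)
Definition tvs_bounded : set (set E) :=
  [set B | forall U, nbhs 0 U ->
    exists2 s : K, 0 < s & forall r : K, s < r -> B `<=` *:%R r @` U].

Definition linear_span A : set E :=
  [set x | exists n (a : 'I_n -> K) (v : 'I_n -> E),
    (forall i, A (v i)) /\ x = \sum_(i < n) a i *: v i].

Definition supercyclic T : Prop :=
  exists x : E, dense [set lambda *: iter n T x | lambda in [set: K] & n in [set: nat]].

Definition cesaro_mean T (n : nat) (x : E) : E :=
  n%:R^-1 *: \sum_(1 <= m < n.+1) iter m T x.

End TopologicalVectorSpaces.

(* The space of all complex sequences. Its algebraic structure is the pointwise
   one and its topology and uniformity are those of the countable product. *)
Definition omega (R : realType) : Type := nat -> R[i]^o.

HB.instance Definition _ (R : realType) := GRing.Lmodule.on (omega R).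
HB.instance Definition _ (R : realType) := Pointed.on (omega R).
HB.instance Definition _ (R : realType) :=
  Uniform.copy (omega R) (prod_topology (fun _ : nat => R[i]^o)).

Section OmegaTvs.
Context (R : realType).
Local Notation omega := (omega R).

Lemma omega_cvgP (F : set_system omega) (x : omega) : Filter F ->
  F --> x <-> forall n, (fun y : omega => y n) @ F --> x n.
Proof. by move=> FF; exact: (@pointwise_cvgP nat R[i]^o F x FF). Qed.

Lemma omega_proj_cvg (n : nat) (x : omega) :
  (fun y : omega => y n) @ nbhs x --> x n.
Proof. by move/omega_cvgP : (@cvg_id _ (nbhs x)); exact. Qed.

Let omega_add_continuous : continuous (fun z : omega * omega => z.1 + z.2).
Proof.
move=> z; apply/omega_cvgP => n /=.
apply: (@cvgD _ R[i]^o _ (nbhs z) _ (fun z : omega * omega => z.1 n)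
  (fun z => z.2 n)).
  by apply: (@cvg_comp _ _ _ fst (fun y : omega => y n) _ (nbhs z.1));
    [exact: cvg_fst|exact: omega_proj_cvg].
by apply: (@cvg_comp _ _ _ snd (fun y : omega => y n) _ (nbhs z.2));
  [exact: cvg_snd|exact: omega_proj_cvg].
Qed.

Let omega_scale_continuous :
  continuous (fun z : R[i]^o * omega => z.1 *: z.2).
Proof.
move=> z; apply/omega_cvgP => n /=.
apply: (@cvgZ _ R[i]^o _ (nbhs z) _ (fun z : R[i]^o * omega => z.1)
  (fun z => z.2 n)).
  exact: cvg_fst.
by apply: (@cvg_comp _ _ _ snd (fun y : omega => y n) _ (nbhs z.2));
  [exact: cvg_snd|exact: omega_proj_cvg].
Qed.

Let omega_locally_convex :
  exists2 B : set_system omega, (forall b, b \in B -> convex_set b) & basis B.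
Proof.
exists [set b | open b /\ convex_set b]; first by move=> b /set_mem[].
split; first by move=> b [].
move=> x; have FF : Filter (filter_from
    [set b : set omega | (open b /\ convex_set b) /\ b x] id).
  apply: filter_from_filter => [|b c [[ob cb] bx] [[oc cc] cx]].
    by exists setT; split=> //; split; [exact: openT|move=> *; rewrite inE].
  exists (b `&` c) => //; split=> //; split; first exact: openI.
  move=> y z l /set_mem [yb yc] /set_mem [zb zc]; apply/mem_set; split.
    by apply/set_mem/cb; exact: mem_set.
  by apply/set_mem/cc; exact: mem_set.
apply/omega_cvgP => n U Ux.
have [B cB [oB nB]] := @locally_convex R[i] R[i]^o.
have [b [Bb bx] bU] := nB (x n) U Ux.
exists ((fun y : omega => y n) @^-1` b); last by move=> y; exact: bU.
split=> //; split.
  apply: open_comp; last exact: oB.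
  by move=> y _; exact: omega_proj_cvg.
move=> y z l /set_mem yb /set_mem zb; apply/mem_set/set_mem.
by apply: (cB b (mem_set Bb) (y n) (z n) l); exact: mem_set.
Qed.

HB.instance Definition _ :=
  PreTopologicalNmodule_isTopologicalNmodule.Build omega omega_add_continuous.
HB.instance Definition _ :=
  TopologicalNmodule_isTopologicalLmodule.Build R[i] omega
    omega_scale_continuous.
HB.instance Definition _ :=
  Uniform_isTvs.Build R[i] omega omega_locally_convex.

End OmegaTvs.

(* [equicontinuous] and [{family _, _ --> _}] refer to the uniformity of the
   target. They are used on [omega] only, whose uniformity is the translation
   invariant one: a general [tvsType] may carry any uniformity inducing its
   topology. *)
Section OperatorsOnOmega.
Context {R : realType}.
Implicit Types T : omega R -> omega R.

Definition power_bounded T : Prop :=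
  equicontinuous [set n : nat | (0 < n)%N] (fun n => iter n T).

(* The topology of L_b(omega) is the trace on L(omega) of the topology of
   uniform convergence on the bounded sets. *)
Definition uniformly_mean_ergodic T : Prop :=
  exists2 P : omega R -> omega R, continuous_linear P &
    {family tvs_bounded, cesaro_mean T @ \oo --> P}.

Definition generalized_cesaro (t : R) (x : omega R) : omega R :=
  fun n => (\sum_(i < n.+1) t%:C ^+ (n - i) * x i) / n.+1%:R.

Definition unit_vector (r : nat) : omega R := fun j => (r == j)%:R.

End OperatorsOnOmega.

(* Main.v *)
(* Row n of C_t has absolute sum at most 1, so C_t does not increase any of the
   seminorms max_{i <= N} |x_i|; this gives power boundedness. With
   z_n := sum_{i <= n} t^(n-i) x_i, one has x_{n+1} = z_{n+1} - t z_n and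
   (C_t x)_n = z_n / (n+1), so (I - C_t) x = y is a first-order recursion on z,
   solvable exactly when y_0 = 0 and by a map bounded for these seminorms.
   Hence x = x_0 (t^n)_n + (I - C_t) y with y bounded in terms of x, and the
   n-th Cesaro mean of the coboundary telescopes to (C_t y - C_t^{n+1} y) / n.
   Finally C_t fixes x_0 and halves x_1 - t x_0, so every w in the projective
   orbit of x satisfies |w_1 - t w_0| |x_0| <= |x_1 - t x_0| |w_0|, which is
   incompatible with density. *)
Require Import Defs.
From mathcomp Require Import all_boot all_order all_algebra.
From mathcomp Require Import all_classical all_reals all_analysis.
From mathcomp Require Import complex ring.

Import Order.TTheory GRing.Theory Num.Theory.
Import numFieldNormedType.Exports.

Local Open Scope classical_set_scope.
Local Open Scope ring_scope.
Local Open Scope complex_scope.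

(** * Neighbourhoods, bounded sets and closures in [omega], in terms of finitely many coordinates *)

Section OmegaTopology.
Context {R : realType}.
Implicit Types (x y : omega R) (D : set (omega R)).

Definition omegaE := (
  ((fun x y n => erefl) : forall x y n, (x - y) n = x n - y n),
  ((fun x y n => erefl) : forall x y n, (x + y) n = x n + y n),
  ((fun a x n => erefl) : forall (a : R[i]) x n, (a *: x) n = a * x n)).

(** An entourage of the product contains a finite intersection of preimages of coordinate
    entourages. The sets controlled by one entourage on the first coordinates form a filter [G], so
    it suffices that [G] contains each such preimage. *)
Lemma omega_entourage (E : set (omega R * omega R)) : entourage E ->
  exists N (e : R[i]), 0 < e /\
    forall x y, (forall i, (i <= N)%N -> `|x i - y i| <= e) -> E (x, y).
Proof.
move=> entE.
pose G : set_system (omega R * omega R) := fun E =>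
  exists N (A : set (R[i]^o * R[i]^o)), entourage A /\
  forall x y, (forall i, (i <= N)%N -> A (x i, y i)) -> E (x, y).
have FG : Filter G.
  split.
  - by exists 0%N, setT; split=> //; exact: entourageT.
  - move=> P Q [N [A [eA AP]]] [M [B [eB BQ]]].
    exists (maxn N M), (A `&` B); split; first exact: filterI.
    by move=> x y xy; split; [apply: AP|apply: BQ] => i iN;
      have [] := xy i; rewrite ?leq_max ?iN ?orbT.
  - move=> P Q PQ [N [A [eA AP]]]; exists N, A; split=> // x y xy.
    by apply: PQ; exact: AP.
have [N [A [entA AE]]] : G E.
  case: entE => _ [F _ <-] sE; apply: filterS sE _.
  apply: filter_bigI => -[[i V] /= /asboolP [W entW WV]] _.
  by exists i, W; split=> // x y xy; apply: WV; exact: xy.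
move: entA; rewrite -entourage_ballE => -[e /= e0 eA].
(* Halving the radius turns the strict inequality of a ball into a large one. *)
exists N, (e / 2); split; first exact: divr_gt0.
move=> x y xy; apply: AE => i iN; apply: eA => /=.
rewrite -ball_normE /=; apply: le_lt_trans (xy i iN) _.
by rewrite ltr_pdivrMr // ltr_pMr // ltr1n.
Qed.

Lemma near_omega x N (e : R[i]) : 0 < e ->
  \forall y \near x, forall i, (i <= N)%N -> `|x i - y i| <= e.
Proof.
move=> e0; elim: N => [|N IH].
  have /cvgrPdist_le/(_ e e0) := @omega_proj_cvg R 0%N x.
  by apply: filterS => y xy i; rewrite leqn0 => /eqP ->.
have /cvgrPdist_le/(_ e e0) := @omega_proj_cvg R N.+1 x.
apply: filterS2 IH => y IH xy i; rewrite leq_eqVlt => /predU1P[->//|].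
exact: IH.
Qed.

Lemma nbhs_omega x (U : set (omega R)) : nbhs x U ->
  exists N (e : R[i]), 0 < e /\
    forall y, (forall i, (i <= N)%N -> `|x i - y i| <= e) -> U y.
Proof.
rewrite -nbhs_entourageE => -[E entE EU].
have [N [e [e0 eE]]] := omega_entourage _ entE.
by exists N, e; split=> // y xy; apply: EU; apply/mem_set; exact: eE.
Qed.

Lemma dense_omega D : dense D -> forall x N (e : R[i]), 0 < e ->
  exists2 y, D y & forall i, (i <= N)%N -> `|x i - y i| <= e.
Proof.
move=> dD x N e e0.
have ne0 : [set y : omega R | forall i, (i <= N)%N -> `|x i - y i| <= e]^° !=set0.
  by exists x; exact: near_omega.
have [y [/interior_subset xy Dy]] := dD _ ne0 (open_interior _).
by exists y.
Qed.

Lemma tvs_bounded_omega (B : set (omega R)) N : tvs_bounded B ->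
  exists2 M : R[i], 0 < M &
    forall x, B x -> forall i, (i <= N)%N -> `|x i| <= M.
Proof.
(* Any factor above [s] absorbs [B] into the set where the coordinates up to [N] have norm at most
   1, so that factor is the bound. *)
move=> /(_ _ (near_omega 0 N 1 ltr01)) [s s0 /(_ (s + 1))].
have s10 : 0 < s + 1 by exact: addr_gt0.
rewrite ltrDl ltr01 => /(_ isT) sB; exists (s + 1) => // x /sB [y /= yB <-] i iN.
rewrite normrM (gtr0_norm s10) ger_pMr //.
by have := yB i iN; rewrite sub0r normrN.
Qed.

Lemma closed_omega_coord0 : closed [set x : omega R | x 0%N = 0].
Proof.
rewrite -[X in closed X]/((fun x : omega R => x 0%N) @^-1` [set (0 : R[i]^o)]).
apply: closed_comp; first by move=> x _; exact: omega_proj_cvg.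
exact/accessible_closed_set1/hausdorff_accessible/norm_hausdorff.
Qed.

Lemma scale_unit_vectorE (a : R[i]) r j :
  (a *: unit_vector r : omega R) j = a * (r == j)%:R.
Proof. by []. Qed.

Lemma closure_span_unit_vector :
  closure (linear_span [set unit_vector r | r in [set r | (0 < r)%N]]) =
  [set x : omega R | x 0%N = 0].
Proof.
rewrite eqEsubset; split=> [|x /= x0 U /nbhs_omega [N [e [e0 eU]]]].
  have /closure_id -> := closed_omega_coord0.
  apply: closureS => _ [n [a [v [vr ->]]]] /=.
  rewrite fct_sumE big1 // => i _.
  by have [r /= r0 <-] := vr i; rewrite scale_unit_vectorE gtn_eqF // mulr0.
(* The truncation of [x] agrees with [x] on all coordinates up to [N], index 0 included because
   [x 0 = 0]. *)
exists (\sum_(i < N) x i.+1 *: unit_vector i.+1); split.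
  exists N, (fun i => x i.+1), (fun i => unit_vector i.+1); split=> // i.
  by exists i.+1.
apply: eU => -[|i] iN; rewrite fct_sumE.
  rewrite x0 big1 ?subr0 ?normr0 ?ltW // => i _.
  by rewrite scale_unit_vectorE mulr0.
rewrite (bigD1 (Ordinal iN)) //= big1 => [|j ji].
  by rewrite addr0 scale_unit_vectorE eqxx mulr1 subrr normr0 ltW.
rewrite scale_unit_vectorE eqSS; case: eqP => [jE|_]; last exact: mulr0.
by move: ji; rewrite -val_eqE /= jE eqxx.
Qed.

End OmegaTopology.

(** * Kernel and range of I - C_t *)

Section GeneralizedCesaro.
Context {R : realType} (t : R).
Implicit Types (x y : omega R) (a M : R[i]).
Local Notation C := (generalized_cesaro t).

Definition geometric_sequence : omega R := fun n => t%:C ^+ n.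

Definition geometric_convolution x (n : nat) : R[i] :=
  \sum_(i < n.+1) t%:C ^+ (n - i) * x i.

Lemma geometric_convolutionS x n : geometric_convolution x n.+1 =
  t%:C * geometric_convolution x n + x n.+1.
Proof.
rewrite /geometric_convolution big_ord_recr /= subnn expr0 mul1r; congr (_ + _).
rewrite mulr_sumr; apply: eq_bigr => i _.
by rewrite subSn ?exprS ?mulrA // -ltnS.
Qed.

Lemma generalized_cesaroE x n :
  C x n = geometric_convolution x n / n.+1%:R.
Proof. by []. Qed.

Lemma generalized_cesaro0 x : C x 0%N = x 0%N.
Proof.
by rewrite generalized_cesaroE /geometric_convolution big_ord1 expr0 mul1r divr1.
Qed.

Lemma generalized_cesaro_linear : linear C.
Proof.
move=> a x y; apply/funext => n.
rewrite !omegaE !generalized_cesaroE mulrA -mulrDl; congr (_ / _).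
rewrite mulr_sumr -big_split; apply: eq_bigr => i _ /=.
by rewrite !omegaE mulrDr mulrCA.
Qed.

(** All n+1 terms t^(n-i) a t^i of the convolution equal a t^n. *)
Lemma generalized_cesaro_geometric a :
  C (a *: geometric_sequence) = a *: geometric_sequence.
Proof.
apply/funext => n; rewrite generalized_cesaroE.
rewrite (_ : geometric_convolution _ n = a * t%:C ^+ n *+ n.+1).
  by rewrite -mulr_natr mulfK // pnatr_eq0.
rewrite /geometric_convolution -[n.+1 in RHS]card_ord -sumr_const.
apply: eq_bigr => i _; rewrite omegaE mulrCA -exprD subnK //.
by rewrite -ltnS.
Qed.

Lemma generalized_cesaro_fixed x :
  x - C x = 0 -> x = x 0%N *: geometric_sequence.
Proof.
move=> /subr0_eq Cx.
have xE n : geometric_convolution x n = x n * n.+1%:R.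
  by rewrite {2}Cx generalized_cesaroE divfK // pnatr_eq0.
apply/funext; elim=> [|n IH]; first by rewrite [RHS]mulr1.
(* The recursion becomes (n+2) x_{n+1} = t (n+1) x_n + x_{n+1}; subtracting x_{n+1} and cancelling
   n+1 gives x_{n+1} = t x_n. *)
have := geometric_convolutionS x n; rewrite !xE.
move/eqP; rewrite -subr_eq -[X in _ - X]mulr1 -mulrBr.
rewrite -[in X in X - _]natr1 addrK mulrA => /eqP/mulIf -> //.
  by rewrite IH !omegaE /geometric_sequence exprS [RHS]mulrCA.
Qed.

(* A solution of [x - C x = y], for [y 0 = 0], is read off the recursion
   satisfied by [z := geometric_convolution x], where [z 0 = x 0] is free. *)
Fixpoint resolvent_convolution y n : R[i] :=
  if n is n'.+1 then n.+1%:R / n%:R * (y n + t%:C * resolvent_convolution y n')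
  else 0.

(** The free value is set to 0; other solutions differ by multiples of the geometric sequence. *)
Definition resolvent y : omega R := fun n =>
  if n is n'.+1 then resolvent_convolution y n - t%:C * resolvent_convolution y n'
  else 0.

Lemma geometric_convolution_resolvent y :
  geometric_convolution (resolvent y) = resolvent_convolution y.
Proof.
apply/funext; elim=> [|n IH].
  by rewrite /geometric_convolution big_ord1 mulr0.
by rewrite geometric_convolutionS IH /= addrC subrK.
Qed.

Lemma resolventK y : y 0%N = 0 -> resolvent y - C (resolvent y) = y.
Proof.
move=> y0; apply/funext => n.
rewrite omegaE generalized_cesaroE.
rewrite geometric_convolution_resolvent.
case: n => [|n]; first by rewrite y0 /= mul0r subrr.
(* Here m = n+1, u = y_{n+1} and w = t z_n, so that z_{n+1} = (m+1)/m (u+w). *)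
have step (m u w : R[i]) : m != 0 -> m + 1 != 0 ->
    (m + 1) / m * (u + w) - w - (m + 1) / m * (u + w) / (m + 1) = u.
  by move=> m0 m1; field; rewrite m0 m1.
rewrite [resolvent _ _]/(_ - _) [resolvent_convolution y n.+1]/= -[n.+2%:R]natr1.
by apply: step; rewrite ?natr1 pnatr_eq0.
Qed.

Lemma range_sub_generalized_cesaro :
  range (fun x => x - C x) = [set x : omega R | x 0%N = 0].
Proof.
rewrite eqEsubset; split=> [_ [x _ <-]|x x0] /=.
  by rewrite omegaE generalized_cesaro0 subrr.
by exists (resolvent x) => //; exact: resolventK.
Qed.

Lemma ker_sub_generalized_cesaro a : a != 0 ->
  [set x | x - C x = 0] = linear_span [set a *: geometric_sequence].
Proof.
move=> a0; rewrite eqEsubset; split=> [x /generalized_cesaro_fixed xE|x] /=.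
  exists 1%N, (fun=> x 0%N / a), (fun=> a *: geometric_sequence); split=> //.
  by rewrite big_ord1 scalerA divfK.
move=> [n [b [v [vE ->]]]].
rewrite (eq_bigr (fun i => (b i * a) *: geometric_sequence)) => [|i _].
  by rewrite -scaler_suml generalized_cesaro_geometric subrr.
by rewrite vE scalerA.
Qed.

End GeneralizedCesaro.

Lemma cesaro_mean_fixed_coboundary {K : numFieldType} {E : tvsType K}
    (T : E -> E) (p y : E) n : linear T -> T p = p -> (0 < n)%N ->
  cesaro_mean T n (p + (y - T y)) = p + n%:R^-1 *: (T y - iter n.+1 T y).
Proof.
move=> linT Tp n0.
have TD u v : T (u + v) = T u + T v by have := linT 1 u v; rewrite !scale1r.
have TB u v : T (u - v) = T u - T v.
  by rewrite -scaleN1r addrC linT scaleN1r addrC.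
have iterT m : iter m T (p + (y - T y)) = p - (iter m.+1 T y - iter m T y).
  by rewrite opprB; elim: m => //= m ->; rewrite TD TB Tp.
(* The sum starts at m = 1, so the surviving initial term is [T y], not [y]. *)
rewrite /cesaro_mean (eq_bigr _ (fun m _ => iterT m)) sumrB telescope_sumr //.
rewrite opprB sumr_const_nat subn1 /= -(scaler_nat n p) scalerDr scalerA mulVf ?scale1r //.
by rewrite pnatr_eq0 -lt0n.
Qed.

(** The order of [R[i]] is partial, but a modulus is the image of a real number, to which the
    Archimedean property of [R] applies. *)
Lemma exists_nat_norm_le {R : realType} (z : R[i]) : exists n : nat, `|z| <= n%:R.
Proof.
have [a /normr_idP a0 ->] : exists2 a : R, `|a| = a & `|z| = a%:C.
  by eexists; last exact: normc_def; rewrite ger0_norm // sqrtr_ge0.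
exists (Num.bound a); rewrite -(rmorph_nat (real_complex R)) lecR ltW //.
exact: archi_boundP.
Qed.

Lemma norm_real_complex_le1 {R : realType} {t : R} :
  0 <= t <= 1 -> `|t%:C| <= 1.
Proof. by case/andP=> t0 t1; rewrite ger0_norm ?lecR // -[0]/(0%:C) lecR. Qed.

(** * Seminorm bounds, power boundedness and mean ergodicity *)

Section Ergodicity.
Context {R : realType} {t : R} (t01 : 0 <= t <= 1).
Implicit Types (x y : omega R) (M : R[i]).
Local Notation C := (generalized_cesaro t).

Let norm_t_le1 : `|t%:C| <= 1 := norm_real_complex_le1 t01.

Lemma generalized_cesaro_norm_le x n M :
  (forall i, (i <= n)%N -> `|x i| <= M) -> `|C x n| <= M.
Proof.
move=> xM; rewrite generalized_cesaroE normrM normfV normr_nat.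
rewrite ler_pdivrMr ?ltr0n // mulr_natr -[n.+1 in X in _ <= X]card_ord -sumr_const.
apply: le_trans (ler_norm_sum _ _ _) _; apply: ler_sum => i _.
rewrite normrM normrX; apply: le_trans (xM i _); last by rewrite -ltnS.
by rewrite ler_piMl // exprn_ile1.
Qed.

Lemma iter_generalized_cesaro_norm_le m x N M :
    (forall i, (i <= N)%N -> `|x i| <= M) ->
  forall i, (i <= N)%N -> `|iter m C x i| <= M.
Proof.
move=> xM; elim: m => //= m IH i iN; apply: generalized_cesaro_norm_le => j ji.
exact/IH/(leq_trans ji).
Qed.

Lemma iter_generalized_cesaro_linear m : linear (iter m C).
Proof.
by move=> a x y; elim: m => //= m ->; exact: generalized_cesaro_linear.
Qed.

Lemma generalized_cesaro_power_bounded : power_bounded C.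
Proof.
move=> x E /omega_entourage [N [e [e0 eE]]].
have := near_omega x N e e0; apply: filterS => y xy n _; apply: eE => i iN.
(* By linearity the difference of iterates is an iterate of [x - y], so one neighbourhood serves
   every [n]. *)
have -> : iter n C x i - iter n C y i = iter n C (x - y) i.
  rewrite [x - y]addrC -(scaleN1r y) iter_generalized_cesaro_linear.
  by rewrite scaleN1r !omegaE addrC.
exact: iter_generalized_cesaro_norm_le iN.
Qed.

Lemma generalized_cesaro_continuous : continuous C.
Proof.
exact: (equicontinuous_continuous (i := 1%N) generalized_cesaro_power_bounded).
Qed.

Lemma resolvent_convolution_norm_le N : exists2 c : R[i], 0 <= c &
  forall y M, (forall i, (i <= N)%N -> `|y i| <= M) ->
    forall i, (i <= N)%N -> `|resolvent_convolution t y i| <= c * M.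
Proof.
elim: N => [|N [c c0 cM]].
  exists 0 => // y M _ i; rewrite leqn0 => /eqP -> /=.
  by rewrite mul0r normr0.
pose q : R[i] := `|N.+2%:R / N.+1%:R|.
have q0 : 0 <= q by exact: normr_ge0.
have qc0 : 0 <= q * (1 + c) by rewrite mulr_ge0 // addr_ge0.
(* The term q(1+c) comes from |z_{N+1}| <= q (|y_{N+1}| + |t z_N|); the summand c covers the smaller
   indices. *)
exists (c + q * (1 + c)) => [|y M yM i]; first exact: addr_ge0.
have M0 : 0 <= M by exact: le_trans (normr_ge0 _) (yM _ (leq0n _)).
have cN j : (j <= N)%N -> `|resolvent_convolution t y j| <= c * M.
  by apply: cM => k kN; exact/yM/leqW.
rewrite leq_eqVlt mulrDl => /predU1P[->|/cN iM]; last first.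
  by apply: le_trans iM _; rewrite lerDl mulr_ge0.
apply: ler_wpDl; first exact: mulr_ge0.
rewrite [resolvent_convolution _ _ _]/= normrM -/q -mulrA ler_wpM2l //.
apply: le_trans (ler_normD _ _) _; rewrite mulrDl mul1r lerD ?yM //.
by rewrite normrM; apply: le_trans (cN _ (leqnn N)); rewrite ler_piMl.
Qed.

Lemma resolvent_norm_le N : exists c : R[i],
  forall y M, (forall i, (i <= N)%N -> `|y i| <= M) ->
    forall i, (i <= N)%N -> `|resolvent t y i| <= c * M.
Proof.
have [c c0 cM] := resolvent_convolution_norm_le N; exists (c + c) => y M yM [|i] iN.
  rewrite normr0 mulr_ge0 ?addr_ge0 //.
  exact: le_trans (normr_ge0 _) (yM _ iN).
rewrite [resolvent _ _ _]/(_ - _); apply: le_trans (ler_normB _ _) _.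
rewrite mulrDl lerD ?cM //.
by rewrite normrM; apply: le_trans (cM _ _ yM _ (ltnW iN)); rewrite ler_piMl.
Qed.

Lemma continuous_linear_coord0_scale (g : omega R) :
  continuous_linear (fun x => x 0%N *: g).
Proof.
split=> [a x y|x]; first by rewrite omegaE scalerDl scalerA.
have FF : Filter ((fun y => y 0%N *: g) @ nbhs x) by exact: fmap_filter.
apply/omega_cvgP => n.
apply: (@cvgZ _ R[i]^o _ (nbhs x) _ (fun y : omega R => y 0%N) (fun=> g n)).
  exact: omega_proj_cvg.
exact: cvg_cst.
Qed.

Lemma generalized_cesaro_uniformly_mean_ergodic : uniformly_mean_ergodic C.
Proof.
(* The limit projects onto the fixed points; [x - P x] vanishes at index 0, hence is a
   coboundary. *)
pose P x := x 0%N *: geometric_sequence t.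
exists P; first exact: continuous_linear_coord0_scale.
apply/fam_cvgP => B bB U /uniform_nbhs [E [entE EU]].
have [N [e [e0 eE]]] := omega_entourage _ entE.
have [M M0 BM] := tvs_bounded_omega B N bB.
have [c cM] := resolvent_norm_le N.
(* On [B], [x - P x] is bounded by 2M, so [y] and its iterates by c(2M); the numerator of the
   telescoped mean is then at most twice that. *)
have [k ek] := exists_nat_norm_le ((c * (M + M) + c * (M + M)) / e).
exists k.+1 => // n /= kn; apply: EU => x Bx; apply: eE => i iN.
pose y := resolvent t (x - P x).
have yK : y - C y = x - P x.
  by apply: resolventK; rewrite /P !omegaE /geometric_sequence expr0 mulr1 subrr.
have yM j : (j <= N)%N -> `|y j| <= c * (M + M).
  apply: cM => l lN; rewrite /P !omegaE; apply: le_trans (ler_normB _ _) _.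
  rewrite lerD ?BM // normrM normrX; apply: le_trans (BM x Bx _ (leq0n N)).
  by rewrite ler_piMr // exprn_ile1.
have n0 : (0 < n)%N by exact: leq_trans kn.
have -> : cesaro_mean C n x = P x + n%:R^-1 *: (C y - iter n.+1 C y).
  have := cesaro_mean_fixed_coboundary C (P x) y n
    (generalized_cesaro_linear t) (generalized_cesaro_geometric t _) n0.
  by rewrite yK [P x + (x - P x)]addrC subrK.
rewrite !omegaE opprD addNKr normrN normrM normfV normr_nat.
rewrite mulrC ler_pdivrMr ?ltr0n // mulrC.
apply: (@le_trans _ _ (c * (M + M) + c * (M + M))).
  apply: le_trans (ler_normB _ _) _.
  have iter_le m := iter_generalized_cesaro_norm_le m y N _ yM i iN.
  by apply: lerD; [exact: (iter_le 1%N)|exact: iter_le].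
rewrite -ler_pdivrMr //; apply: le_trans (le_trans ek _); last first.
  by rewrite ler_nat ltnW.
(* The quotient must be real to lie below its norm; c(2M) is nonnegative since it dominates a
   norm. *)
have cM0 : 0 <= c * (M + M) := le_trans (normr_ge0 _) (yM _ iN).
by rewrite real_ler_norm // ger0_real // divr_ge0 ?addr_ge0 // ltW.
Qed.

End Ergodicity.

(** * Failure of supercyclicity *)

Section Supercyclicity.
Context {R : realType} (t : R).
Implicit Types x : omega R.
Local Notation C := (generalized_cesaro t).

Lemma iter_generalized_cesaro0 n x : iter n C x 0%N = x 0%N.
Proof. by elim: n => //= n IH; rewrite generalized_cesaro0. Qed.

(** The functional x_1 - t x_0 is an eigenvector of the transpose of C_t, with eigenvalue 1/2. *)
Lemma iter_generalized_cesaro1 n x :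
  iter n C x 1%N - t%:C * x 0%N = (x 1%N - t%:C * x 0%N) / 2 ^+ n.
Proof.
elim: n => [|n IH]; first by rewrite divr1.
rewrite exprSr invfM mulrA -IH iterS generalized_cesaroE geometric_convolutionS.
rewrite /geometric_convolution big_ord1 expr0 mul1r iter_generalized_cesaro0.
have half (u v : R[i]) : (u + v) / 2 - u = (v - u) / 2 by field.
exact: half.
Qed.

Lemma generalized_cesaro_not_supercyclic : 0 <= t <= 1 -> ~ supercyclic C.
Proof.
move=> /norm_real_complex_le1 t1 [x dx]; pose u := x 1%N - t%:C * x 0%N.
have orbit0 l n : (l *: iter n C x) 0%N = l * x 0%N.
  by rewrite omegaE iter_generalized_cesaro0.
(* If x_0 = 0, the whole projective orbit vanishes at index 0 and stays away from e_0. Otherwise it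
   cannot approach e_1. *)
have [x0|x0] := eqVneq (x 0%N) 0.
  have half_gt0 : 0 < 2^-1 :> R[i] by rewrite invr_gt0 ltr0n.
  have [_ [l _ [n _ <-]] /(_ 0%N isT)] :=
    dense_omega _ dx (unit_vector 0) 0%N 2^-1 half_gt0.
  rewrite orbit0 x0 mulr0 subr0 /unit_vector normr1 invf_ge1 ?ltr0n //.
  by rewrite lern1.
have a0 : 0 < `|x 0%N| by rewrite normr_gt0.
(* The estimates below give |x_0| <= (2|x_0| + |u|) e, which fails for e = |x_0| / (3|x_0| +
   |u|). *)
have ab0 : 0 < `|x 0%N| *+ 3 + `|u| by rewrite ltr_wpDr // mulrn_wgt0.
have [z [l _ [n _ lz]] wz] :=
  dense_omega _ dx (unit_vector 1) 1%N _ (divr_gt0 a0 ab0).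
have := wz 0%N isT; have := wz 1%N isT; set e := _ / _.
rewrite /unit_vector /= sub0r normrN => z1 z0.
have zu : `|z 1%N - t%:C * z 0%N| * `|x 0%N| <= `|u| * `|z 0%N|.
  rewrite -lz orbit0 !omegaE mulrCA -mulrBr iter_generalized_cesaro1 -/u.
  rewrite !normrM [leRHS]mulrCA -!mulrA !ler_wpM2l // ler_piMl //.
  rewrite normfV normrX normr_nat invf_le1 ?exprn_gt0 ?ltr0n //.
  by rewrite exprn_ege1 // ler1n.
(* Split 1 = (1 - z_1) + (z_1 - t z_0) + t z_0; the outer terms have norm at most e. *)
have le_1 : 1 <= e + `|z 1%N - t%:C * z 0%N| + e.
  rewrite -[X in X <= _]normr1.
  rewrite -[X in `|X| <= _](subrK (z 1%N)) -[X in _ - _ + X](subrK (t%:C * z 0%N)).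
  rewrite addrA; apply: le_trans (ler_normD _ _) _; rewrite lerD //.
    by apply: le_trans (ler_normD _ _) _; rewrite lerD.
  by rewrite normrM; apply: le_trans z0; rewrite ler_piMl.
have : `|x 0%N| <= (`|x 0%N| *+ 2 + `|u|) * e.
  rewrite -[leLHS]mul1r; apply: le_trans (ler_wpM2r (normr_ge0 _) le_1) _.
  rewrite mulrDl mulrDl addrAC [leRHS]mulrDl mulr2n mulrDl.
  rewrite ![e * _]mulrC lerD //; apply: le_trans zu _; exact: ler_wpM2l.
rewrite /e mulrA ler_pdivlMr // [leLHS]mulrC ler_pM2r // lerD2r mulrSr.
by rewrite gerDl (lt_geF a0).
Qed.

End Supercyclicity.

Theorem theorem6p1 (R : realType) (t : R) (alpha0 : R[i]) (x0 : omega R)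
    (t01 : 0 <= t < 1) (alpha0_neq0 : alpha0 != 0)
    (x0E : x0 = alpha0 *: ((fun n => t%:C ^+ n) : omega R)) :
  let C_t := generalized_cesaro t in
  [/\ [/\ continuous_linear C_t, power_bounded C_t & uniformly_mean_ergodic C_t],
      [/\ [set x : omega R | x - C_t x = 0] = linear_span [set x0],
          range (fun x => x - C_t x) = [set x : omega R | x 0%N = 0],
          [set x : omega R | x 0%N = 0] =
            closure (linear_span [set unit_vector r | r in [set r | (0 < r)%N]])
        & closed (range (fun x => x - C_t x))]
    & ~ supercyclic C_t].
Proof.
have t01' : 0 <= t <= 1 by case/andP: t01 => -> /ltW.
move=> C_t; rewrite range_sub_generalized_cesaro closure_span_unit_vector x0E.
split; [split|split|] => //.
- split; [exact: generalized_cesaro_linear|exact: generalized_cesaro_continuous].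
- exact: generalized_cesaro_power_bounded.
- exact: generalized_cesaro_uniformly_mean_ergodic.
- exact: ker_sub_generalized_cesaro.
- exact: closed_omega_coord0.
exact: generalized_cesaro_not_supercyclic.
Qed.
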